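(* Let $A$ and $B$ be $0$-cells of a closed bicategory $\mathcal{B}$, and let $F$ be a family of functors $F_C:\mathcal{B}(A,C)\to\mathcal{B}(B,C)$, one for each $0$-cell $C$ of $\mathcal{B}$ (subscripts on $F$ are suppressed below). The following are equivalent. (1) For any $0$-cells $C_1,C_2,C_3$ and any $1$-cells $T\in\mathcal{B}(A,C_1)$, $U\in\mathcal{B}(A,C_2)$, $V\in\mathcal{B}(A,C_3)$ there are $2$-cells $$T\triangleright U\to FT\triangleright FU\ \text{ in }\mathcal{B}(C_1,C_2),\qquad U\triangleright V\to FU\triangleright FV\ \text{ in }\mathcal{B}(C_2,C_3),$$ natural in $T,U,V$, which commute with composition and preserve units, in the following sense: the two composites $$(U\triangleright V)\odot(T\triangleright U)\xrightarrow{\text{comp}}T\triangleright V\to FT\triangleright FV$$ and $$(U\triangleright V)\odot(T\triangleright U)\to(FU\triangleright FV)\odot(FT\triangleright FU)\xrightarrow{\text{comp}}FT\triangleright FV$$ agree, and the composite $C_1\to T\triangleright T\to FT\triangleright FT$ equals $C_1\to FT\triangleright FT$, where the maps out of the unit $1$-cell $C_1$ into $T\triangleright T$ and $FT\triangleright FT$ are the adjoints of the unit isomorphisms $C_1\odot T\cong T$ and $C_1\odot FT\cong FT$. (2) The family $F$ is the family of components for a transformation of represented pseudofunctors $\mathcal{B}(A,-)\to\mathcal{B}(B,-)$. That is, for any $1$-cells $X\in\mathcal{B}(A,C_1)$ and $K\in\mathcal{B}(C_1,C_2)$ there are $2$-cells $$K\odot F(X)\to F(K\odot X)\ \text{ in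 }\mathcal{B}(B,C_2),$$ natural in $K$ and $X$, and associative and unital.
   Context: For $0$-cells $A,B$ of a bicategory $\mathcal{B}$, $\mathcal{B}(A,B)$ is the category of $1$-cells $A\to B$ and $2$-cells. The horizontal composite of $M\in\mathcal{B}(A,B)$ and $L\in\mathcal{B}(B,C)$ is $L\odot M\in\mathcal{B}(A,C)$. The unit $1$-cell of a $0$-cell $A$ is also denoted $A$. $\mathcal{B}$ is closed if for every $1$-cell $M$ the functors $-\odot M$ and $M\odot-$ have right adjoints, denoted $M\triangleright-$ and $-\triangleleft M$ respectively: $\mathcal{B}(V\odot M,W)\cong\mathcal{B}(V,M\triangleright W)$ and $\mathcal{B}(M\odot T,U)\cong\mathcal{B}(T,U\triangleleft M)$ (sets of $2$-cells). If $M:A\to B$ and $W:A\to C$, then $M\triangleright W:B\to C$. The composition $2$-cell $\text{comp}:(U\triangleright V)\odot(T\triangleright U)\to T\triangleright V$ is adjoint to the two-fold evaluation $(U\triangleright V)\odot(T\triangleright U)\odot T\to(U\triangleright V)\odot U\to V$. The represented pseudofunctor $\mathcal{B}(A,-):\mathcal{B}\to\mathrm{Cat}$ sends a $0$-cell $E$ to $\mathcal{B}(A,E)$ and a $1$-cell $M$ to $M\odot-$. ''Associative and unital'' in (2) means: suppressing associativity isomorphisms, the composite $L\odot K\odot F(X)\to L\odot F(K\odot X)\to F(L\odot K\odot X)$ equals the structure $2$-cell for $L\odot K$, and the structure $2$-cell $C\odot F(X)\to F(C\odot X)$ for the unit $1$-cell $C$ is compatible with the unit isomorphisms $C\odot F(X)\cong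 F(X)\cong F(C\odot X)$. A transformation $\mathcal{B}(A,-)\to\mathcal{B}(B,-)$ consists of a family of component functors $F_C$ and such structure $2$-cells. *)

(* Defs.v *)
(* Plain Rocq without library theories; morphisms and 2-cells are compared by
   Leibniz equality. *)

Set Implicit Arguments.
Unset Strict Implicit.
Unset Printing Implicit Defensive.

Declare Scope bicat_scope.
Delimit Scope bicat_scope with bicat.
Open Scope bicat_scope.

Reserved Notation "x ⇒ y" (at level 70, no associativity).
Reserved Notation "g ∘ f" (at level 40, left associativity).
Reserved Notation "L ⊙ M" (at level 39, right associativity).
Reserved Notation "b ⊙₂ a" (at level 39, right associativity).
Reserved Notation "M ▷ W" (at level 38, no associativity).

Record Category := {
  ob :> Type;
  mor : ob -> ob -> Type;
  idm : forall x, mor x x;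
  comp : forall x y z, mor y z -> mor x y -> mor x z;
  comp_idl : forall x y (f : mor x y), comp (idm y) f = f;
  comp_idr : forall x y (f : mor x y), comp f (idm x) = f;
  comp_assoc : forall x y z w (h : mor z w) (g : mor y z) (f : mor x y),
    comp h (comp g f) = comp (comp h g) f
}.

Arguments mor {c} x y.
Arguments idm {c} x.
Arguments comp {c x y z} g f.

Notation "x ⇒ y" := (mor x y) : bicat_scope.
Notation "g ∘ f" := (comp g f) : bicat_scope.

Record Functor (C D : Category) := {
  fob :> C -> D;
  fmap : forall x y : C, (x ⇒ y) -> (fob x ⇒ fob y);
  fmap_id : forall x : C, fmap (idm x) = idm (fob x);
  fmap_comp : forall (x y z : C) (g : y ⇒ z) (f : x ⇒ y),
    fmap (g ∘ f) = fmap g ∘ fmap f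
}.

Arguments fmap {C D} f {x y} _ : rename.

Record Adjunction (C D : Category) (L : Functor C D) (R : Functor D C) := {
  transpose : forall (x : C) (y : D), (L x ⇒ y) -> (x ⇒ R y);
  untranspose : forall (x : C) (y : D), (x ⇒ R y) -> (L x ⇒ y);
  transposeK : forall (x : C) (y : D) (f : L x ⇒ y),
    untranspose (transpose f) = f;
  untransposeK : forall (x : C) (y : D) (g : x ⇒ R y),
    transpose (untranspose g) = g;
  transpose_natl : forall (x x' : C) (y : D) (f : L x ⇒ y) (h : x' ⇒ x),
    transpose (f ∘ fmap L h) = transpose f ∘ h;
  transpose_natr : forall (x : C) (y y' : D) (f : L x ⇒ y) (k : y ⇒ y'),
    transpose (k ∘ f) = fmap R k ∘ transpose f
}.

Record RightAdjoint (C D : Category) (L : Functor C D) := {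
  radj :> Functor D C;
  radjP : Adjunction L radj
}.

Record Bicategory := {
  cell0 :> Type;
  hom : cell0 -> cell0 -> Category;

  unit1 : forall A, hom A A;
  hcomp : forall A B C, hom B C -> hom A B -> hom A C;
  hcomp2 : forall A B C (L L' : hom B C) (M M' : hom A B),
    (L ⇒ L') -> (M ⇒ M') -> (hcomp L M ⇒ hcomp L' M');
  hcomp2_id : forall A B C (L : hom B C) (M : hom A B),
    hcomp2 (idm L) (idm M) = idm (hcomp L M);
  hcomp2_comp : forall A B C (L L' L'' : hom B C) (M M' M'' : hom A B)
      (b' : L' ⇒ L'') (b : L ⇒ L') (a' : M' ⇒ M'') (a : M ⇒ M'),
    hcomp2 (b' ∘ b) (a' ∘ a) = hcomp2 b' a' ∘ hcomp2 b a;

  assoc : forall A B C D (N : hom C D) (L : hom B C) (M : hom A B),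
    hcomp (hcomp N L) M ⇒ hcomp N (hcomp L M);
  assoc_inv : forall A B C D (N : hom C D) (L : hom B C) (M : hom A B),
    hcomp N (hcomp L M) ⇒ hcomp (hcomp N L) M;
  assocK : forall A B C D (N : hom C D) (L : hom B C) (M : hom A B),
    assoc_inv N L M ∘ assoc N L M = idm _;
  assoc_invK : forall A B C D (N : hom C D) (L : hom B C) (M : hom A B),
    assoc N L M ∘ assoc_inv N L M = idm _;
  assoc_nat : forall A B C D (N N' : hom C D) (L L' : hom B C)
      (M M' : hom A B) (c : N ⇒ N') (b : L ⇒ L') (a : M ⇒ M'),
    assoc N' L' M' ∘ hcomp2 (hcomp2 c b) a
    = hcomp2 c (hcomp2 b a) ∘ assoc N L M;

  lunit : forall A B (M : hom A B), hcomp (unit1 B) M ⇒ M;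
  lunit_inv : forall A B (M : hom A B), M ⇒ hcomp (unit1 B) M;
  lunitK : forall A B (M : hom A B), lunit_inv M ∘ lunit M = idm _;
  lunit_invK : forall A B (M : hom A B), lunit M ∘ lunit_inv M = idm _;
  lunit_nat : forall A B (M M' : hom A B) (a : M ⇒ M'),
    lunit M' ∘ hcomp2 (idm (unit1 B)) a = a ∘ lunit M;

  runit : forall A B (M : hom A B), hcomp M (unit1 A) ⇒ M;
  runit_inv : forall A B (M : hom A B), M ⇒ hcomp M (unit1 A);
  runitK : forall A B (M : hom A B), runit_inv M ∘ runit M = idm _;
  runit_invK : forall A B (M : hom A B), runit M ∘ runit_inv M = idm _;
  runit_nat : forall A B (M M' : hom A B) (a : M ⇒ M'),
    runit M' ∘ hcomp2 a (idm (unit1 A)) = a ∘ runit M;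

  pentagon : forall A B C D E
      (P : hom D E) (N : hom C D) (L : hom B C) (M : hom A B),
    assoc P N (hcomp L M) ∘ assoc (hcomp P N) L M
    = hcomp2 (idm P) (assoc N L M) ∘ assoc P (hcomp N L) M
      ∘ hcomp2 (assoc P N L) (idm M);
  triangle : forall A B C (L : hom B C) (M : hom A B),
    hcomp2 (idm L) (lunit M) ∘ assoc L (unit1 B) M
    = hcomp2 (runit L) (idm M)
}.

Arguments hom {_} A B.
Arguments unit1 {_} A.
Arguments hcomp {_ A B C} L M.
Arguments hcomp2 {_ A B C L L' M M'} b a.
Arguments assoc {_ A B C D} N L M.
Arguments assoc_inv {_ A B C D} N L M.
Arguments lunit {_ A B} M.
Arguments lunit_inv {_ A B} M.
Arguments runit {_ A B} M.
Arguments runit_inv {_ A B} M.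

Notation "L ⊙ M" := (hcomp L M) : bicat_scope.
Notation "b ⊙₂ a" := (hcomp2 b a) : bicat_scope.

Definition precomp (B : Bicategory) (X Y Z : B) (M : hom X Y) :
  Functor (hom Y Z) (hom X Z).
Proof.
refine {| fob := fun V : hom Y Z => V ⊙ M;
          fmap := fun V V' (v : V ⇒ V') => v ⊙₂ idm M |}.
- intros V; apply hcomp2_id.
- intros V V' V'' v' v; rewrite <- hcomp2_comp, comp_idl; reflexivity.
Defined.

Definition postcomp (B : Bicategory) (X Y Z : B) (M : hom Y Z) :
  Functor (hom X Y) (hom X Z).
Proof.
refine {| fob := fun T : hom X Y => M ⊙ T;
          fmap := fun T T' (t : T ⇒ T') => idm M ⊙₂ t |}.
- intros T; apply hcomp2_id.
- intros T T' T'' t' t; rewrite <- hcomp2_comp, comp_idl; reflexivity.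
Defined.

Arguments precomp {B X Y} Z M.
Arguments postcomp {B} X {Y Z} M.

(* [rhom M] is M ▷ - and [lhom M] is - ◁ M. *)
Record ClosedBicategory := {
  bicat :> Bicategory;
  rhom : forall (X Y Z : bicat) (M : hom X Y),
    RightAdjoint (precomp Z M);
  lhom : forall (X Y Z : bicat) (M : hom Y Z),
    RightAdjoint (postcomp X M)
}.

Arguments rhom {_ X Y Z} M.
Arguments lhom {_ X Y Z} M.

Notation "M ▷ W" := (fob (radj (rhom M)) W) : bicat_scope.

Section InternalHom.
Variable B : ClosedBicategory.

Definition curry (X Y Z : B) (M : hom X Y) (V : hom Y Z) (W : hom X Z)
    (f : V ⊙ M ⇒ W) : V ⇒ M ▷ W :=
  transpose (radjP (rhom M)) f.

Definition uncurry (X Y Z : B) (M : hom X Y) (V : hom Y Z) (W : hom X Z)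
    (g : V ⇒ M ▷ W) : V ⊙ M ⇒ W :=
  untranspose (radjP (rhom M)) g.

Definition eval (X Y Z : B) (M : hom X Y) (W : hom X Z) : (M ▷ W) ⊙ M ⇒ W :=
  uncurry (idm (M ▷ W)).

Definition rhom_cov (X Y Z : B) (T : hom X Y) (U U' : hom X Z) (u : U ⇒ U') :
    T ▷ U ⇒ T ▷ U' :=
  fmap (rhom T) u.

(* The contravariant action of ▷ in its first variable, determined by the
   adjunctions: the adjoint of (T ▷ U) ⊙ T' -> (T ▷ U) ⊙ T -> U. *)
Definition rhom_contra (X Y Z : B) (T T' : hom X Y) (t : T' ⇒ T)
    (U : hom X Z) : T ▷ U ⇒ T' ▷ U :=
  curry (eval T U ∘ (idm (T ▷ U) ⊙₂ t)).

Definition rhom_comp (X Y1 Y2 Y3 : B)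
    (T : hom X Y1) (U : hom X Y2) (V : hom X Y3) :
    (U ▷ V) ⊙ (T ▷ U) ⇒ T ▷ V :=
  curry (eval U V ∘ (idm (U ▷ V) ⊙₂ eval T U) ∘ assoc (U ▷ V) (T ▷ U) T).

Definition rhom_unit (X Y : B) (T : hom X Y) : unit1 Y ⇒ T ▷ T :=
  curry (lunit T).

End InternalHom.

Section FamiliesOfFunctors.
Variables (BB : ClosedBicategory) (A B : BB).
Variable F : forall C : BB, Functor (hom A C) (hom B C).

Local Notation "'F₀' X" := (fob (F _) X) (at level 9, X at level 9).
Local Notation "'F₁' f" := (fmap (F _) f) (at level 9, f at level 9).

Definition hom_cells : Type :=
  forall (C1 C2 : BB) (T : hom A C1) (U : hom A C2),
    T ▷ U ⇒ (F₀ T) ▷ (F₀ U).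

Record natural_compatible (theta : hom_cells) : Prop := {
  theta_nat_contra : forall (C1 C2 : BB) (T T' : hom A C1) (U : hom A C2)
      (t : T' ⇒ T),
    theta C1 C2 T' U ∘ rhom_contra t U
    = rhom_contra (F₁ t) (F₀ U) ∘ theta C1 C2 T U;
  theta_nat_cov : forall (C1 C2 : BB) (T : hom A C1) (U U' : hom A C2)
      (u : U ⇒ U'),
    theta C1 C2 T U' ∘ rhom_cov T u
    = rhom_cov (F₀ T) (F₁ u) ∘ theta C1 C2 T U;
  theta_comp : forall (C1 C2 C3 : BB)
      (T : hom A C1) (U : hom A C2) (V : hom A C3),
    theta C1 C3 T V ∘ rhom_comp T U V
    = rhom_comp (F₀ T) (F₀ U) (F₀ V)
      ∘ (theta C2 C3 U V ⊙₂ theta C1 C2 T U);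
  theta_unit : forall (C1 : BB) (T : hom A C1),
    theta C1 C1 T T ∘ rhom_unit T = rhom_unit (F₀ T)
}.

Definition structure_cells : Type :=
  forall (C1 C2 : BB) (K : hom C1 C2) (X : hom A C1),
    K ⊙ F₀ X ⇒ F₀ (K ⊙ X).

(* [phi] makes F a transformation BB(A,-) -> BB(B,-) of represented
   pseudofunctors; the 2-cells phi are not required to be invertible. *)
Record is_transformation (phi : structure_cells) : Prop := {
  phi_nat1 : forall (C1 C2 : BB) (K K' : hom C1 C2) (X : hom A C1)
      (k : K ⇒ K'),
    phi C1 C2 K' X ∘ (k ⊙₂ idm (F₀ X))
    = F₁ (k ⊙₂ idm X) ∘ phi C1 C2 K X;
  phi_nat2 : forall (C1 C2 : BB) (K : hom C1 C2) (X X' : hom A C1)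
      (x : X ⇒ X'),
    phi C1 C2 K X' ∘ (idm K ⊙₂ F₁ x)
    = F₁ (idm K ⊙₂ x) ∘ phi C1 C2 K X;
  phi_assoc : forall (C1 C2 C3 : BB)
      (L : hom C2 C3) (K : hom C1 C2) (X : hom A C1),
    phi C2 C3 L (K ⊙ X) ∘ (idm L ⊙₂ phi C1 C2 K X) ∘ assoc L K (F₀ X)
    = F₁ (assoc L K X) ∘ phi C1 C3 (L ⊙ K) X;
  phi_unit : forall (C : BB) (X : hom A C),
    F₁ (lunit X) ∘ phi C C (unit1 C) X = lunit (F₀ X)
}.

End FamiliesOfFunctors.

(* Main.v *)
Require Import Defs.

(** Both kinds of structure on F are the same data read through the
    adjunction between - ⊙ M and M ▷ -.  A family [theta] of 2-cells
    T ▷ U -> FT ▷ FU and a family [phi] of 2-cells K ⊙ FX -> F(K ⊙ X) are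
    called corresponding when, for each g : V -> T ▷ U with adjoint
    g' : V ⊙ T -> U, the adjoint of [theta] ∘ g is

      V ⊙ FT --phi--> F(V ⊙ T) --F(g')--> FU.

    Taking g to be the identity of T ▷ U determines [theta] from [phi]; taking
    g to be the coevaluation K -> X ▷ (K ⊙ X), whose adjoint is an identity,
    determines [phi] from [theta].  That these two recipes produce
    corresponding families is where naturality of [phi] in K
    ([theta_of_phi_corresponds]) and of [theta] in U
    ([phi_of_theta_corresponds]) is used.

    Conversely the correspondence, because it holds for every g, already
    contains both of these naturality conditions.  The other axioms match one
    by one ([corresponds_compatible_iff_transformation]), by comparing
    adjoints: naturality of [theta] in T is naturality of [phi] in X,
    compatibility with composition is associativity (given naturality of [phi]
    in X), and compatibility with units is unitality.  Each comparison rests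
    on knowing the adjoint of one operation on internal homs, given by
    [uncurry_rhom_contra], [uncurry_rhom_comp] and, for units, [curryK]. *)

Set Implicit Arguments.
Unset Strict Implicit.
Unset Printing Implicit Defensive.

(** * Adjoints of the operations on internal homs *)

Section Adjoints.
Variable B : ClosedBicategory.

Lemma curryK (X Y Z : B) (M : hom X Y) (V : hom Y Z) (W : hom X Z)
    (f : V ⊙ M ⇒ W) : uncurry (curry f) = f.
Proof. exact (transposeK (radjP (rhom M)) f). Qed.

Lemma uncurryK (X Y Z : B) (M : hom X Y) (V : hom Y Z) (W : hom X Z)
    (g : V ⇒ M ▷ W) : curry (uncurry g) = g.
Proof. exact (untransposeK (radjP (rhom M)) g). Qed.

Lemma uncurry_inj (X Y Z : B) (M : hom X Y) (V : hom Y Z) (W : hom X Z)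
    (g g' : V ⇒ M ▷ W) : uncurry g = uncurry g' -> g = g'.
Proof. intros e; rewrite <- (uncurryK g), e; apply uncurryK. Qed.

Lemma uncurry_precomp (X Y Z : B) (M : hom X Y) (V V' : hom Y Z)
    (W : hom X Z) (g : V ⇒ M ▷ W) (h : V' ⇒ V) :
  uncurry (g ∘ h) = uncurry g ∘ (h ⊙₂ idm M).
Proof.
pose proof (transpose_natl (radjP (rhom M)) (uncurry g) h) as e.
change (curry (uncurry g ∘ (h ⊙₂ idm M)) = curry (uncurry g) ∘ h) in e.
rewrite uncurryK in e; rewrite <- e; apply curryK.
Qed.

Lemma uncurry_rhom_cov (X Y Z : B) (M : hom X Y) (V : hom Y Z)
    (W W' : hom X Z) (w : W ⇒ W') (g : V ⇒ M ▷ W) :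
  uncurry (rhom_cov M w ∘ g) = w ∘ uncurry g.
Proof.
pose proof (transpose_natr (radjP (rhom M)) (uncurry g) w) as e.
change (curry (w ∘ uncurry g) = rhom_cov M w ∘ curry (uncurry g)) in e.
rewrite uncurryK in e; rewrite <- e; apply curryK.
Qed.

Lemma uncurry_eval (X Y Z : B) (M : hom X Y) (V : hom Y Z) (W : hom X Z)
    (g : V ⇒ M ▷ W) : uncurry g = eval M W ∘ (g ⊙₂ idm M).
Proof.
unfold eval; rewrite <- uncurry_precomp, comp_idl; reflexivity.
Qed.

Lemma interchange_l (X Y Z : B) (L L' : hom Y Z) (M M' : hom X Y)
    (b : L ⇒ L') (a : M ⇒ M') :
  (b ⊙₂ idm M') ∘ (idm L ⊙₂ a) = b ⊙₂ a.
Proof. rewrite <- hcomp2_comp, comp_idl, comp_idr; reflexivity. Qed.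

Lemma interchange_r (X Y Z : B) (L L' : hom Y Z) (M M' : hom X Y)
    (b : L ⇒ L') (a : M ⇒ M') :
  (idm L' ⊙₂ a) ∘ (b ⊙₂ idm M) = b ⊙₂ a.
Proof. rewrite <- hcomp2_comp, comp_idl, comp_idr; reflexivity. Qed.

Lemma whisker_l_comp (X Y Z : B) (L : hom Y Z) (M M' M'' : hom X Y)
    (a' : M' ⇒ M'') (a : M ⇒ M') :
  idm L ⊙₂ (a' ∘ a) = (idm L ⊙₂ a') ∘ (idm L ⊙₂ a).
Proof. rewrite <- hcomp2_comp, comp_idl; reflexivity. Qed.

Lemma uncurry_rhom_contra (X Y Z : B) (T T' : hom X Y) (t : T' ⇒ T)
    (V : hom Y Z) (U : hom X Z) (g : V ⇒ T ▷ U) :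
  uncurry (rhom_contra t U ∘ g) = uncurry g ∘ (idm V ⊙₂ t).
Proof.
unfold rhom_contra; rewrite uncurry_precomp, curryK, (uncurry_eval g).
rewrite <- !comp_assoc, interchange_l, interchange_r; reflexivity.
Qed.

(** With g ⊙₂ f precomposed, the two-fold evaluation that defines
    [rhom_comp] becomes an iterated use of the adjoints of f and g.  Stating
    this for arbitrary f and g makes it apply both to composites of [theta]
    and to coevaluations. *)
Lemma uncurry_rhom_comp (X Y1 Y2 Y3 : B)
    (T : hom X Y1) (U : hom X Y2) (V : hom X Y3)
    (L : hom Y2 Y3) (K : hom Y1 Y2) (g : L ⇒ U ▷ V) (f : K ⇒ T ▷ U) :
  uncurry (rhom_comp T U V ∘ (g ⊙₂ f))
  = uncurry g ∘ (idm L ⊙₂ uncurry f) ∘ assoc L K T.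
Proof.
unfold rhom_comp; rewrite uncurry_precomp, curryK.
rewrite <- !comp_assoc, assoc_nat.
rewrite (uncurry_eval g), (uncurry_eval f), !comp_assoc; f_equal.
rewrite <- !comp_assoc, <- !hcomp2_comp, !comp_idl, comp_idr; reflexivity.
Qed.

End Adjoints.

(** * Corresponding families of 2-cells *)

Section Correspondence.
Variables (BB : ClosedBicategory) (A B : BB).
Variable F : forall C : BB, Functor (hom A C) (hom B C).

Definition corresponds (theta : hom_cells F) (phi : structure_cells F) : Prop :=
  forall (C1 C2 : BB) (T : hom A C1) (U : hom A C2) (V : hom C1 C2)
    (g : V ⇒ T ▷ U),
    uncurry (theta C1 C2 T U ∘ g) = fmap (F C2) (uncurry g) ∘ phi C1 C2 V T.

Definition theta_of_phi (phi : structure_cells F) : hom_cells F :=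
  fun C1 C2 T U => curry (fmap (F C2) (eval T U) ∘ phi C1 C2 (T ▷ U) T).

Definition phi_of_theta (theta : hom_cells F) : structure_cells F :=
  fun C1 C2 K X => uncurry (theta C1 C2 X (K ⊙ X) ∘ curry (idm (K ⊙ X))).

Lemma theta_of_phi_corresponds (phi : structure_cells F) :
  is_transformation phi -> corresponds (theta_of_phi phi) phi.
Proof.
intros H C1 C2 T U V g; unfold theta_of_phi.
rewrite uncurry_precomp, curryK, <- comp_assoc, (phi_nat1 H), comp_assoc.
rewrite <- fmap_comp, <- uncurry_eval; reflexivity.
Qed.

(** A 2-cell g : V -> T ▷ U factors as the coevaluation of V followed by the
    covariant action of its adjoint, past which [theta] can be moved. *)
Lemma phi_of_theta_corresponds (theta : hom_cells F) :
  natural_compatible theta -> corresponds theta (phi_of_theta theta).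
Proof.
intros H C1 C2 T U V g; unfold phi_of_theta.
assert (e : rhom_cov T (uncurry g) ∘ curry (idm (V ⊙ T)) = g).
{ apply uncurry_inj; rewrite uncurry_rhom_cov, curryK, comp_idr; reflexivity. }
rewrite <- uncurry_rhom_cov, comp_assoc, <- (theta_nat_cov H), <- comp_assoc.
rewrite e; reflexivity.
Qed.

Section AxiomTranslation.
Variables (theta : hom_cells F) (phi : structure_cells F).
Hypothesis corr : corresponds theta phi.

Lemma corresponds_theta (C1 C2 : BB) (T : hom A C1) (U : hom A C2) :
  uncurry (theta T U) = fmap (F C2) (eval T U) ∘ phi (T ▷ U) T.
Proof. rewrite <- (comp_idr (theta T U)); apply corr. Qed.

Lemma corresponds_curry (C1 C2 : BB) (T : hom A C1) (U : hom A C2)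
    (V : hom C1 C2) (f : V ⊙ T ⇒ U) :
  uncurry (theta T U ∘ curry f) = fmap (F C2) f ∘ phi V T.
Proof. rewrite corr, curryK; reflexivity. Qed.

Lemma corresponds_coeval (C1 C2 : BB) (K : hom C1 C2) (X : hom A C1) :
  uncurry (theta X (K ⊙ X) ∘ curry (idm (K ⊙ X))) = phi K X.
Proof. rewrite corresponds_curry, fmap_id; apply comp_idl. Qed.

Lemma transformation_of_compatible :
  natural_compatible theta -> is_transformation phi.
Proof.
intros H; constructor.
- intros C1 C2 K K' X k.
  rewrite <- corresponds_coeval, <- uncurry_precomp, <- comp_assoc, corr.
  rewrite uncurry_precomp, curryK, comp_idl; reflexivity.
- intros C1 C2 K X X' x.
  rewrite <- corresponds_coeval, <- uncurry_rhom_contra, comp_assoc.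
  rewrite <- (theta_nat_contra H), <- comp_assoc, corr.
  rewrite uncurry_rhom_contra, curryK, comp_idl; reflexivity.
- intros C1 C2 C3 L K X.
  (* Both sides are adjoint to the composite in the internal homs of the
     coevaluations of L at K ⊙ X and of K at X, before and after theta. *)
  rewrite <- (corresponds_coeval L), <- (corresponds_coeval K).
  rewrite <- uncurry_rhom_comp, hcomp2_comp, comp_assoc.
  rewrite <- (theta_comp H), <- comp_assoc, corr.
  rewrite uncurry_rhom_comp, !curryK, hcomp2_id, !comp_idl; reflexivity.
- intros C X.
  rewrite <- corresponds_curry.
  change (curry (lunit X)) with (rhom_unit X).
  rewrite (theta_unit H); apply curryK.
Qed.

Lemma compatible_of_transformation :
  is_transformation phi -> natural_compatible theta.
Proof.
intros H; constructor.
- intros C1 C2 T T' U t; apply uncurry_inj.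
  rewrite corr, uncurry_rhom_contra, corresponds_theta.
  rewrite <- (comp_idr (rhom_contra t U)), uncurry_rhom_contra, fmap_comp.
  rewrite <- !comp_assoc, <- (phi_nat2 H); reflexivity.
- intros C1 C2 T U U' u; apply uncurry_inj.
  rewrite corr, uncurry_rhom_cov, corresponds_theta.
  rewrite <- (comp_idr (rhom_cov T u)), uncurry_rhom_cov, fmap_comp.
  symmetry; apply comp_assoc.
- intros C1 C2 C3 T U V; apply uncurry_inj.
  rewrite corr, uncurry_rhom_comp, !corresponds_theta.
  rewrite <- (comp_idr (rhom_comp T U V)), <- hcomp2_id, uncurry_rhom_comp.
  change (uncurry (idm (U ▷ V))) with (eval U V).
  change (uncurry (idm (T ▷ U))) with (eval T U).
  rewrite !fmap_comp, <- !comp_assoc, <- (phi_assoc H), whisker_l_comp.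
  f_equal; rewrite !comp_assoc, (phi_nat2 H); reflexivity.
- intros C T; apply uncurry_inj; unfold rhom_unit.
  rewrite corresponds_curry, (phi_unit H), curryK; reflexivity.
Qed.

Lemma corresponds_compatible_iff_transformation :
  natural_compatible theta <-> is_transformation phi.
Proof.
split; [apply transformation_of_compatible | apply compatible_of_transformation].
Qed.

End AxiomTranslation.
End Correspondence.

Unset Implicit Arguments.

Theorem mainTheorem2 (BB : ClosedBicategory) (A B : BB)
    (F : forall C : BB, Functor (hom A C) (hom B C)) :
  (exists theta : hom_cells F, natural_compatible theta)
  <->
  (exists phi : structure_cells F, is_transformation phi).
Proof.
split.
- intros [theta H]; exists (phi_of_theta theta).
  apply (corresponds_compatible_iff_transformation
           (phi_of_theta_corresponds H)), H.
- intros [phi H]; exists (theta_of_phi phi).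
  apply (corresponds_compatible_iff_transformation
           (theta_of_phi_corresponds H)), H.
Qed.
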